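(* Let $q$ be odd, $\varepsilon=\left(\frac{-1}{q}\right)$, $m=(q-\varepsilon)/4$. (i) The map $\pi(b)=b^2-2$ is a permutation of $\mathcal B_2^{-+}$, and for $b\in\mathcal B_2^{-+}$, $\pi^{-1}(b)=\prod\{b-a: a\in\mathcal B_2^{--}\}$; moreover $\pi^{-1}(b)$ is the unique square root of $2+b$ such that $2+\sqrt{2+b}$ is a square. (ii) The map $\sigma(b)=2-b^2$ is a permutation of $\mathcal B_2^{+-}$, and for $b\in\mathcal B_2^{+-}$, $\sigma^{-1}(b)=-\left(\frac{2}{q}\right)\prod\{b-a:a\in\mathcal B_2^{--}\}$; moreover $\sigma^{-1}(b)$ is the unique square root of $2-b$ such that $\sqrt{2-b}+2$ is a nonsquare. (iii) Let $\lambda\in{\mathbb F}_q^\times$ and $\nu=\left(\frac{2\lambda}{q}\right)$. Then $\pi_\lambda(b)=(2\nu/\lambda)b^2-\nu\lambda$ is a permutation of $\mathcal B_\lambda^{-+}$ and $\sigma_\lambda(b)=-(2\nu/\lambda)b^2+\nu\lambda$ is a permutation of $\mathcal B_\lambda^{+-}$, with inverses $\pi_\lambda^{-1}(b)=(2\nu/\lambda)^{m-1}\prod\{b-a:a\in\mathcal B_\lambda^{-\nu,-\nu}\}$ for $b\in\mathcal B_\lambda^{-+}$ and $\sigma_\lambda^{-1}(b)=-\left(\frac2q\right)(2\nu/\lambda)^{m-1}\prod\{b-a:a\in\mathcal B_\lambda^{-\nu,-\nu}\}$ for $b\in\mathcal B_\lambda^{+-}$. If $b\in\mathcal B_\lambda^{-+}$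 and $c=\pi_\lambda^{-1}(b)$ then $c$ is the square root of $(\lambda\nu b+\lambda^2)/2$ for which $c+\lambda$ is a square; if $b\in\mathcal B_\lambda^{+-}$ and $c=\sigma_\lambda^{-1}(b)$ then $c$ is the square root of $(-\lambda\nu b+\lambda^2)/2$ for which $c+\lambda$ is a nonsquare.
   Context: $\left(\frac{a}{q}\right)$ is the Legendre symbol on ${\mathbb F}_q$ ($1$ for nonzero squares, $-1$ for nonsquares, $0$ at $0$). For $\lambda\in{\mathbb F}_q^\times$ and $\varepsilon_1,\varepsilon_2\in\{1,-1\}$ (written $+,-$), $\mathcal B_\lambda^{\varepsilon_1,\varepsilon_2}=\{b\in{\mathbb F}_q:\left(\frac{\lambda-b}{q}\right)=\varepsilon_1,\ \left(\frac{\lambda+b}{q}\right)=\varepsilon_2\}$. *)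

(* Defs.v *)
From HB Require Import structures.
From mathcomp Require Import all_boot all_order all_algebra all_field.
Set Implicit Arguments. Unset Strict Implicit. Unset Printing Implicit Defensive.
Import Order.TTheory GRing.Theory Num.Theory.
Local Open Scope ring_scope.

Definition legendre (F : finFieldType) (a : F) : int :=
  if a == 0 then 0 else if [exists x : F, x ^+ 2 == a] then 1 else -1.

Definition Bset (F : finFieldType) (lam : F) (e1 e2 : int) : {set F} :=
  [set b : F | (legendre (lam - b) == e1) && (legendre (lam + b) == e2)].

Definition m_of (F : finFieldType) : nat :=
  if legendre (-1 : F) == 1 then ((#|F| - 1) %/ 4)%N else ((#|F| + 1) %/ 4)%N.

(* Main.v *)
(* Write a = u + 1/u with u in an algebraic closure of F, so that
   (2 + a) u = (u + 1)^2 and (2 - a) u = - (u - 1)^2. By Euler's criterion and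
   the Frobenius, the Legendre symbols of 2 + a and 2 - a can be read off u^n,
   where n = (q - 1)/2 or (q + 1)/2. Hence u^(2m) = -1 when a lies in B_2^{--},
   so a is a root of the Dickson polynomial D_m, for which
   D_m(u + 1/u) = u^m + u^-m. A character sum gives #|B_2^{--}| = m, so D_m is
   the product of the X - a over B_2^{--}. For b = u + 1/u in B_2^{-+} one finds
   u^(2m) = u or 1/u, so D_m(b)^2 = u^(2m) + u^(-2m) + 2 = b + 2, and the
   Legendre symbol of 2 + D_m(b) is read off u^m in the same way. Taking a = 0
   gives (2/q) = (-1)^m, which turns (i) into (ii) through b -> -b, and (iii)
   follows by the rescaling b -> (2 nu / lam) b. *)
Require Import Defs.
From HB Require Import structures.
From mathcomp Require Import all_boot all_order all_algebra all_field.
From mathcomp Require Import ring zify.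
Import Order.TTheory GRing.Theory Num.Theory.
Local Open Scope ring_scope.

(** * Finite fields of odd order *)

Section OddFiniteField.
Set Implicit Arguments.
Unset Strict Implicit.
Variable F : finFieldType.
Hypothesis Hq : odd #|F|.

Let h := #|F|./2.

Lemma card_odd_finField : #|F| = h.*2.+1.
Proof. by rewrite -[LHS]odd_double_half Hq. Qed.

Lemma half_card_gt0 : (0 < h)%N.
Proof. by have := finNzRing_gt1 F; rewrite card_odd_finField ltnS double_gt0. Qed.

(** In characteristic 2 the order is a power of 2, odd only when it is 1. *)
Lemma two_neq0 : (2 : F) != 0.
Proof.
apply/negP => F2; have ch2: 2%N \in [pchar F] by rewrite inE /= F2.
have := finNzRing_gt1 F; have := Hq.
by rewrite (card_pprimeChar ch2) oddX; case: (logn _ _).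
Qed.

Lemma one_neqN1 : (1 : F) == -1 = false.
Proof. by rewrite -addr_eq0 -(natrD F 1 1) (negPf two_neq0). Qed.

(** * Frobenius and Euler's criterion through an algebraic closure *)

Section Closure.
Variables (K : closedFieldType) (iota : {rmorphism F -> K}).

Lemma frobeniusD (x y : K) : (x + y) ^+ #|F| = x ^+ #|F| + y ^+ #|F|.
Proof.
have [p pr_p chF] := finPcharP F; apply: exprDn_pchar.
rewrite (card_pprimeChar chF) pnatX (pnatE _ pr_p).
by rewrite (rmorph_pchar iota chF).
Qed.

(** X^q - X splits as the product of the X - a over [F], and this factorization persists in [K]. *)
Lemma frobenius_fixed (x : K) : x ^+ #|F| = x -> exists a, x = iota a.
Proof.
move=> xq; have /(congr1 (fun p => (map_poly iota p).[x])) := finField_genPoly F.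
rewrite rmorphB /= map_polyXn map_polyX !hornerE xq subrr rmorph_prod horner_prod.
move/esym/eqP; rewrite prodf_seq_eq0 => /hasP[a _] /=.
by rewrite rmorphB /= map_polyX map_polyC !hornerE subr_eq0 => /eqP; exists a.
Qed.

Lemma quadratic_root (s p : K) : exists x, x ^+ 2 = s * x - p.
Proof.
have [x] := @solve_monicpoly K 2 (nth 0 [:: - p; s]) isT.
by rewrite !big_ord_recl big_ord0 /= => Dx; exists x; rewrite Dx; ring.
Qed.

Lemma euler_criterion_closure (a : F) : (legendre a)%:~R = a ^+ h.
Proof.
rewrite /legendre; have [-> | a0] := eqVneq a 0.
  by rewrite expr0n eqn0Ngt half_card_gt0.
have aq (x : F) : x != 0 -> x ^+ h.*2 = 1.
  by move=> x0; apply: (mulfI x0); rewrite -exprS -card_odd_finField expf_card mulr1.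
case: existsP => [[x /eqP Dx] | nsq].
  by rewrite -Dx -exprM mul2n aq // -sqrf_eq0 Dx.
have [y] := quadratic_root 0 (- iota a); rewrite mul0r opprK add0r => Dy.
have /eqP := aq _ a0; rewrite -muln2 exprM sqrf_eq1 => /orP[/eqP ah1 | /eqP-> //].
(* If a^h = 1, the square root [y] of [a] in [K] satisfies y^q = y (a^h) = y, so it lies in [F] and
   [a] is a square. *)
have [|b Db] := @frobenius_fixed y.
  by rewrite card_odd_finField exprS -mul2n exprM Dy -rmorphXn /= ah1 rmorph1 mulr1.
by case: nsq; exists b; rewrite -(inj_eq (fmorph_inj iota)) rmorphXn /= -Db Dy.
Qed.

End Closure.

(** * The Legendre symbol as a quadratic character *)

Lemma euler_criterion (a : F) : (legendre a)%:~R = a ^+ h.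
Proof.
by have [K [iota _]] := countable_algebraic_closure F; apply: euler_criterion_closure iota _.
Qed.

Lemma legendre_values (a : F) : legendre a \in [:: 0; 1; -1].
Proof. by rewrite /legendre; case: ifP => // _; case: ifP. Qed.

(** Since 0, 1 and -1 stay distinct in [F], Euler's criterion determines the integer symbol. *)
Lemma legendre_eq (a : F) (e : int) :
  e \in [:: 0; 1; -1] -> a ^+ h = e%:~R -> legendre a = e.
Proof.
rewrite -euler_criterion; move: (legendre_values a); rewrite !inE.
have n10 : 1 == 0 :> F = false := oner_eq0 F.
by case/or3P=> /eqP-> /or3P[]/eqP-> // /eqP;
  rewrite ?rmorphN ?rmorph1 ?rmorph0 /= ?[0 == _]eq_sym ?oppr_eq0 ?n10 1?[-1 == 1]eq_sym ?one_neqN1.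
Qed.

Lemma legendre_prod_values (a b : F) : legendre a * legendre b \in [:: 0; 1; -1].
Proof.
by move: (legendre_values a) (legendre_values b); rewrite !inE;
  case/or3P=> /eqP-> /or3P[]/eqP->.
Qed.

Lemma legendreM (a b : F) : legendre (a * b) = legendre a * legendre b.
Proof.
apply: legendre_eq; first exact: legendre_prod_values.
by rewrite rmorphM /= !euler_criterion exprMn.
Qed.

Lemma legendre_eq0 (a : F) : (legendre a == 0) = (a == 0).
Proof. by rewrite /legendre; case: ifP => // _; case: ifP. Qed.

Lemma legendre0 : legendre (0 : F) = 0.
Proof. by rewrite /legendre eqxx. Qed.

Lemma legendreX2 (a : F) : a != 0 -> legendre (a ^+ 2) = 1.
Proof.
rewrite -sqrf_eq0 /legendre => /negPf->.
by case: existsP => // -[]; exists a.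
Qed.

Lemma legendre4 : legendre (4 : F) = 1.
Proof.
by rewrite -(legendreX2 two_neq0) -[in RHS]natrX.
Qed.

Lemma legendreN1 : legendre (-1 : F) = (-1) ^+ h.
Proof.
apply: legendre_eq; last by rewrite rmorphXn rmorphN rmorph1.
by rewrite -signr_odd; case: odd.
Qed.

(** Here q = 2h + 1 and the symbol of -1 is (-1)^h, so 2m is the even number among h and h + 1. *)
Lemma m_of_double : (m_of F).*2 = (h + odd h)%N.
Proof.
rewrite /m_of legendreN1 -signr_odd card_odd_finField.
have := odd_double_half h; case: (odd h) => /= Dh.
  by rewrite -Dh; lia.
by rewrite -Dh; lia.
Qed.

Lemma m_of_double_even (s : bool) : ~~ odd (h + s) -> (m_of F).*2 = (h + s)%N.
Proof. by rewrite m_of_double oddD oddb; case: (odd h) s => -[]. Qed.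

Lemma m_of_double_odd (s : bool) : odd (h + s) -> (m_of F).*2 = (h + ~~ s)%N.
Proof. by rewrite m_of_double oddD oddb; case: (odd h) s => -[]. Qed.

Lemma m_of_gt0 : (0 < m_of F)%N.
Proof. by rewrite -double_gt0 m_of_double addn_gt0 half_card_gt0. Qed.

(** * Character sums and the size of B_2^{--} *)

(** Otherwise squaring would be onto, hence injective on a finite set, although 1 and -1 have the
    same square. *)
Lemma exists_nonsquare : exists g : F, legendre g = -1.
Proof.
case: (pickP (fun g : F => legendre g == -1)) => [g /eqP|nons]; first by exists g.
have /fin_all_exists[r rK] (x : F) : exists y : F, y ^+ 2 = x.
  have [->|x0] := eqVneq x 0; first by exists 0; rewrite expr0n.
  move: (nons x); rewrite /legendre (negPf x0).
  by case: existsP => // -[y /eqP Dy]; exists y.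
have rI : injective r by move=> x y Exy; rewrite -(rK x) Exy rK.
have [s rs sr] := injF_bij rI.
have sE x : s x = x ^+ 2 by rewrite -[LHS]rK sr.
by have := one_neqN1; rewrite -(can_eq sr) !sE sqrrN eqxx.
Qed.

Lemma sum_legendre : \sum_(x : F) legendre x = 0.
Proof.
have [g g1] := exists_nonsquare.
have g0 : g != 0 by rewrite -legendre_eq0 g1.
have : \sum_(x : F) legendre x = - \sum_(x : F) legendre x.
  rewrite [LHS](reindex_inj (mulfI g0)) -sumrN.
  by apply: eq_bigr => x _; rewrite legendreM g1 mulN1r.
by lia.
Qed.

(** For b != 2 the argument is a nonzero square times 4/(2 - b) - 1, which takes every value except
    -1. The full character sum is 0, so the missing term gives the result. *)
Lemma sum_legendre_4subX2 :
  \sum_(b : F) legendre ((2 - b) * (2 + b)) = - legendre (-1 : F).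
Proof.
have inj4 : injective (fun b : F => 4 / (2 - b) - 1).
  have n4 : (4 : F) != 0 by rewrite -legendre_eq0 legendre4.
  by move=> a b /addIr/(mulfI n4)/invr_inj/addrI/oppr_inj.
have : \sum_(b : F) legendre (4 / (2 - b) - 1) = 0.
  by rewrite -[RHS]sum_legendre [RHS](reindex_inj inj4).
(* At b = 2 the junk value 4 / 0 = 0 makes the reindexing map a bijection of F. *)
rewrite (bigD1 2) //= subrr invr0 mulr0 sub0r => /(canRL (addKr _)); rewrite addr0 => <-.
rewrite (bigD1 2) //= subrr mul0r legendre0 add0r; apply: eq_bigr => b b2.
have b2' : 2 - b != 0 by rewrite subr_eq0 eq_sym.
have ->: (2 - b) * (2 + b) = (2 - b) ^+ 2 * (4 / (2 - b) - 1) by field.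
by rewrite legendreM legendreX2 ?mul1r.
Qed.

(** The product of the two factors 1 - (symbol) is 4 times the indicator function of B_2^{--}; its
    sum over [F] is q minus the symbol of -1, that is 4m. *)
Lemma card_Bset_mm : #|Bset (2 : F) (-1) (-1)| = m_of F.
Proof.
have Sm : \sum_(b : F) legendre (2 - b) = 0.
  rewrite -[RHS]sum_legendre [RHS](reindex_inj (can_inj (subKr (2 : F)))).
  by [].
have Sp : \sum_(b : F) legendre (2 + b) = 0.
  by rewrite -[RHS]sum_legendre [RHS](reindex_inj (addrI (2 : F))).
have pt (b : F) : (1 - legendre (2 - b)) * (1 - legendre (2 + b))
     = if b \in Bset (2 : F) (-1) (-1) then 4 else 0.
  (* At b = 2 and b = -2 one symbol is 0, but the other is that of 4, so the product still
     vanishes. *)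
  rewrite inE; have [->|b2] := eqVneq b 2; first by rewrite subrr -natrD legendre0 legendre4.
  have [->|bN2] := eqVneq b (-2); first by rewrite opprK subrr -natrD legendre0 legendre4.
  have := legendre_eq0 (2 - b); have := legendre_eq0 (2 + b).
  rewrite (addrC 2 b) addr_eq0 subr_eq0 [2 == b]eq_sym (negPf b2) (negPf bN2).
  have := legendre_values (2 - b); have := legendre_values (b + 2).
  by rewrite !inE => /or3P[]/eqP-> /or3P[]/eqP->.
have : \sum_(b : F) (1 - legendre (2 - b)) * (1 - legendre (2 + b)) = #|F|%:Z - legendre (-1 : F).
  under eq_bigr => b _ do rewrite mulrBl mul1r mulrBr mulr1 -legendreM.
  rewrite !sumrB Sm Sp sum_legendre_4subX2 sumr_const.
  by rewrite subr0 sub0r opprK natz.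
under eq_bigr do rewrite pt.
rewrite -big_mkcond /= sumr_const -mulr_natr natz legendreN1 -signr_odd.
have := m_of_double; rewrite card_odd_finField.
by case: (odd h) => /=; lia.
Qed.

(** * Dickson polynomials of the first kind with parameter 1 *)

Fixpoint dickson (n : nat) : {poly F} :=
  match n with
  | 0 => 2%:P
  | n1.+1 => if n1 is n2.+1 then 'X * dickson n1 - dickson n2 else 'X
  end.

(** The two-step recurrence requires control of two consecutive indices. Index 0 only gets a size
    bound because the constant 2 is not monic. *)
Lemma dickson_monic (n : nat) :
  [/\ (size (dickson n) <= n.+1)%N, size (dickson n.+1) = n.+2 & dickson n.+1 \is monic].
Proof.
elim: n => [|n [sn sn1 mn1]]; first by rewrite /= size_polyX monicX size_polyC leq_b1.
have sX : size ('X * dickson n.+1) = n.+3 by rewrite size_monicM ?monicX ?monic_neq0 // sn1 size_polyX.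
have lt : (size (- dickson n) < size ('X * dickson n.+1)%R)%N by rewrite size_polyN sX !ltnS ltnW.
split; first by rewrite sn1.
  by rewrite [dickson _.+2]/(_ * _ - _) size_polyDl.
by rewrite monicE [dickson _.+2]/(_ * _ - _) lead_coefDl // -monicE monicMl ?monicX.
Qed.

(** * The parametrization a = u + 1/u *)

Section JoukowskyParametrization.
Variables (K : closedFieldType) (iota : {rmorphism F -> K}).

Lemma joukowsky_surj (a : F) : exists2 u : K, u != 0 & iota a = u + u^-1.
Proof.
have [u Du] := quadratic_root (iota a) 1; have u0 : u != 0.
  by apply: contra_eq_neq Du => ->; rewrite expr0n mulr0 sub0r eq_sym oppr_eq0 oner_eq0.
by exists u => //; apply: (mulIf u0); rewrite mulrDl mulVf // -expr2 Du subrK.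
Qed.

Lemma legendre_iota (a : F) : iota a ^+ h = (legendre a)%:~R.
Proof. by rewrite -rmorphXn /= -euler_criterion rmorph_int. Qed.

Lemma legendre_eq_iota (a : F) (e : int) :
  e \in [:: 0; 1; -1] -> (legendre a)%:~R = e%:~R :> K -> legendre a = e.
Proof.
move=> e3 Ea; apply: legendre_eq e3 _; apply: (fmorph_inj iota).
by rewrite rmorphXn /= legendre_iota Ea rmorph_int.
Qed.

Lemma horner_dickson (n : nat) (u : K) : u != 0 ->
  (map_poly iota (dickson n)).[u + u^-1] = u ^+ n + u ^- n.
Proof.
move=> u0; suff [] : (map_poly iota (dickson n)).[u + u^-1] = u ^+ n + u ^- n /\
  (map_poly iota (dickson n.+1)).[u + u^-1] = u ^+ n.+1 + u ^- n.+1 by [].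
elim: n => [|n [IHn IHn1]].
  rewrite /= map_polyC map_polyX !hornerE expr0 invr1; split=> //.
  by rewrite -[RHS](rmorph_nat iota 2).
split=> //; rewrite [dickson _.+2]/(_ * _ - _) rmorphB rmorphM /= map_polyX.
rewrite hornerD hornerN hornerM hornerX IHn IHn1 !exprS !invfM.
by field; rewrite u0 expf_neq0.
Qed.

(* Here s = 0 when u ^+ q = u, that is, u lies in F, and s = 1 when u ^+ q = u^-1;
   the Frobenius fixes a, so it maps u to u or u^-1. *)
Lemma joukowsky_legendre (a : F) (u : K) :
  iota a = u + u^-1 -> u != 0 -> a != 2 -> a != -2 ->
  exists s : bool, let n := (h + s)%N in
    (legendre (2 + a))%:~R * u ^+ n = 1 /\ (legendre (2 - a))%:~R * u ^+ n = (-1) ^+ n.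
Proof.
move=> Da u0 a2 aN2.
have Ep : iota (2 + a) * u = (u + 1) ^+ 2.
  by rewrite rmorphD rmorph_nat Da; field.
have Em : iota (2 - a) * u = - (u - 1) ^+ 2.
  by rewrite rmorphB rmorph_nat Da; field.
have up0 : u + 1 != 0.
  by rewrite -sqrf_eq0 -Ep mulf_neq0 // fmorph_eq0 addrC addr_eq0.
have um0 : u - 1 != 0.
  by rewrite -sqrf_eq0 -oppr_eq0 -Em mulf_neq0 // fmorph_eq0 subr_eq0 eq_sym.
(* The powers (u + 1)^q and (u - 1)^q are computed twice: additively by the Frobenius, and through
   [qE] with the squares replaced by [Ep] and [Em], which brings in the symbols. *)
have qE (x : K) : x ^+ #|F| = x * (x ^+ 2) ^+ h.
  by rewrite card_odd_finField exprS -mul2n exprM.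
have Fp : (u + 1) ^+ #|F| = u ^+ #|F| + 1 by rewrite frobeniusD // expr1n.
have Fm : (u - 1) ^+ #|F| = u ^+ #|F| - 1.
  by rewrite frobeniusD // -[X in _ + X]signr_odd Hq.
have uq : u ^+ #|F| + (u ^+ #|F|)^-1 = u + u^-1.
  by rewrite -exprVn -frobeniusD // -Da -rmorphXn /= expf_card.
have uq0 : u ^+ #|F| != 0 by rewrite expf_neq0.
have : (u ^+ #|F| - u) * (u ^+ #|F| * u - 1) == 0.
  rewrite (_ : _ * _ = (u ^+ #|F| * u) * (u ^+ #|F| + (u ^+ #|F|)^-1 - (u + u^-1))).
    by rewrite uq subrr mulr0.
  by field; rewrite u0 uq0.
rewrite mulf_eq0 !subr_eq0 -!legendre_iota => /orP[]/eqP Eu.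
  exists false; rewrite /= addn0 -!exprMn Ep Em.
  split; first by apply: (mulfI up0); rewrite -qE Fp Eu mulr1.
  rewrite [in LHS]exprNn; apply: (mulfI um0); rewrite mulrCA -qE Fm Eu mulrC; ring.
exists true; rewrite /= addn1 !exprSr !mulrA -!exprMn Ep Em.
split.
  by apply: (mulfI up0); rewrite mulrA -qE Fp mulrDl Eu mul1r mulr1 addrC.
rewrite [in LHS]exprNn; apply: (mulfI um0); rewrite mulrA mulrCA -qE -mulrA Fm mulrBl Eu; ring.
Qed.

Lemma sign_eq1_closure (n : nat) : ((-1) ^+ n == 1 :> K) = ~~ odd n.
Proof.
have N11 : (-1 == 1 :> K) = false.
  by rewrite eq_sym -(rmorph1 iota) -rmorphN (inj_eq (fmorph_inj iota)) one_neqN1.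
by rewrite -signr_odd; case: (odd n); rewrite /= ?expr1 ?N11 ?eqxx.
Qed.

(** Two symbols -1 give - u^n = 1 = (-1)^n, so n is even, n = 2m and u^m + u^-m = 0. *)
Lemma root_dickson_Bset_mm (a : F) : a \in Bset (2 : F) (-1) (-1) -> root (dickson (m_of F)) a.
Proof.
rewrite inE => /andP[/eqP am /eqP ap].
have a2 : a != 2 by apply: contra_eq_neq am => ->; rewrite subrr legendre0.
have aN2 : a != -2 by apply: contra_eq_neq ap => ->; rewrite subrr legendre0.
have [u u0 Da] := joukowsky_surj a.
have [s [/=]] := joukowsky_legendre Da u0 a2 aN2.
rewrite am ap rmorphN rmorph1 !mulN1r => Nun1; rewrite Nun1 => /esym/eqP.
rewrite sign_eq1_closure => /m_of_double_even Dn.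
apply/eqP/(fmorph_inj iota); rewrite rmorph0 -horner_map Da horner_dickson //.
have um0 : u ^+ m_of F != 0 by rewrite expf_neq0.
apply: (mulfI um0); rewrite mulr0 mulrDr mulfV // -exprD addnn Dn.
by rewrite -(opprK (u ^+ _)) Nun1 addNr.
Qed.

Lemma prod_Bset_mm (b : F) (u : K) : iota b = u + u^-1 -> u != 0 ->
  iota (\prod_(a in Bset (2 : F) (-1) (-1)) (b - a)) = u ^+ m_of F + u ^- m_of F.
Proof.
move=> Db u0; rewrite -horner_dickson // -Db horner_map; congr (iota _).
(* Positivity of m matters: monicity is only available at successor indices. *)
have [_] := dickson_monic (m_of F).-1; rewrite prednK ?m_of_gt0 // => szD /monicP lcD.
rewrite [dickson _](@all_roots_prod_XsubC _ _ (enum (Bset (2 : F) (-1) (-1)))).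
- rewrite lcD scale1r horner_prod -big_enum.
  by apply: eq_bigr => a _; rewrite !hornerE.
- by rewrite szD -cardE card_Bset_mm.
- by apply/allP => a; rewrite mem_enum; apply: root_dickson_Bset_mm.
- by rewrite uniq_rootsE enum_uniq.
Qed.

(** At a = 0 both symbols are that of 2, so n = 2m; moreover u^2 = -1, hence u^n = (-1)^m. *)
Lemma legendre2_closure : legendre (2 : F) = (-1) ^+ m_of F.
Proof.
have [u u0 D0] := joukowsky_surj 0.
have F20 : (0 : F) != 2 by rewrite eq_sym two_neq0.
have F2N0 : (0 : F) != -2 by rewrite eq_sym oppr_eq0 two_neq0.
have [s [/=]] := joukowsky_legendre D0 u0 F20 F2N0.
rewrite addr0 subr0 => L2; rewrite L2 => /esym/eqP.
rewrite sign_eq1_closure => /m_of_double_even Dn.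
have u2 : u ^+ 2 = -1.
  by apply/eqP; rewrite -addr_eq0 expr2 -[X in _ + X](mulfV u0) -mulrDr -D0 rmorph0 mulr0.
apply: legendre_eq_iota; first by rewrite -signr_odd; case: odd.
move: L2; rewrite -Dn -mul2n exprM u2 => L2.
rewrite rmorphXn rmorphN rmorph1; apply: (mulIf (negbT (signr_eq0 K (m_of F)))).
by rewrite L2 -expr2 sqrr_sign.
Qed.

Lemma prod_Bset_mm_sqrt_closure (b : F) : b \in Bset (2 : F) (-1) 1 ->
  let c := \prod_(a in Bset (2 : F) (-1) (-1)) (b - a) in
  c \in Bset (2 : F) (-1) 1 /\ c ^+ 2 = 2 + b.
Proof.
rewrite inE => /andP[/eqP bm /eqP bp] c.
have b2 : b != 2 by apply: contra_eq_neq bm => ->; rewrite subrr legendre0.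
have bN2 : b != -2 by apply: contra_eq_neq bp => ->; rewrite subrr legendre0.
have [u u0 Db] := joukowsky_surj b.
have [s [/=]] := joukowsky_legendre Db u0 b2 bN2.
rewrite bm bp rmorphN rmorph1 mulN1r mul1r => un1; rewrite un1 => n_odd.
have {}n_odd : odd (h + s).
  by rewrite -[odd _]negbK -sign_eq1_closure -n_odd (sign_eq1_closure 1).
set w := u ^+ m_of F; have w0 : w != 0 by rewrite expf_neq0.
have Dc : iota c = w + w^-1 by exact: prod_Bset_mm.
(* The exponent n = h + s is odd with u^n = 1, and 2m is n + 1 if s = 0 and n - 1 if s = 1. *)
have w2 : w ^+ 2 = u \/ w ^+ 2 = u^-1.
  rewrite -exprM muln2 (m_of_double_odd n_odd); case: s {n_odd} un1 => /=.
    by rewrite addn0 addn1 exprSr => /(canRL (mulfK u0))->; right; rewrite mul1r.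
  by rewrite addn0 addn1 exprSr => ->; left; rewrite mul1r.
have c2 : c ^+ 2 = 2 + b.
  apply: (fmorph_inj iota); rewrite rmorphXn rmorphD rmorph_nat /= Dc Db.
  have ->: (w + w^-1) ^+ 2 = 2 + (w ^+ 2 + (w ^+ 2)^-1) by field.
  by case: w2 => ->; rewrite ?invrK // (addrC u^-1).
have Ec : (2 - c) * (2 + c) = 2 - b by rewrite -subr_sqr c2; ring.
have bm0 : 2 - b != 0 by rewrite -legendre_eq0 bm.
have [cm0 cp0] : 2 - c != 0 /\ 2 + c != 0.
  by apply/andP; rewrite -negb_or -mulf_eq0 Ec.
have c2' : c != 2 by rewrite eq_sym -subr_eq0.
have cN2 : c != -2 by rewrite -addr_eq0 addrC.
(* The symbols of 2 + c and 2 - c are opposite because 2 - b is a nonsquare. This makes the exponent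
   h + t for [w] odd as well, so t = s, and w^(h + s) = (u^(h + s))^m = 1 yields the symbol of 2 +
   c. *)
have [t [/=]] := joukowsky_legendre Dc w0 c2' cN2.
have wn1 : w ^+ (h + s) = 1 by rewrite exprAC un1 expr1n.
have Lc : legendre (2 - c) = - legendre (2 + c).
  have := legendreM (2 - c) (2 + c); rewrite Ec bm.
  by move: (legendre_values (2 - c)) (legendre_values (2 + c)); rewrite !inE;
    case/or3P=> /eqP-> /or3P[]/eqP->.
rewrite Lc rmorphN mulNr => Lp; rewrite Lp => t_odd.
have {}t_odd : odd (h + t).
  by rewrite -[odd _]negbK -sign_eq1_closure -t_odd (sign_eq1_closure 1).
have Et : t = s.
  by move: n_odd t_odd; rewrite !oddD !oddb; case: (odd h) (s) (t) => -[] [].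
have L1 : legendre (2 + c) = 1.
  by apply: legendre_eq_iota => //; move: Lp; rewrite Et wn1 mulr1.
by split=> //; rewrite inE Lc L1 !eqxx.
Qed.

End JoukowskyParametrization.

Lemma legendre2 : legendre (2 : F) = (-1) ^+ m_of F.
Proof.
by have [K [iota _]] := countable_algebraic_closure F; apply: legendre2_closure iota.
Qed.

Lemma prod_Bset_mm_sqrt (b : F) : b \in Bset (2 : F) (-1) 1 ->
  let c := \prod_(a in Bset (2 : F) (-1) (-1)) (b - a) in
  c \in Bset (2 : F) (-1) 1 /\ c ^+ 2 = 2 + b.
Proof.
by have [K [iota _]] := countable_algebraic_closure F; apply: prod_Bset_mm_sqrt_closure iota _.
Qed.

(** * Negation, squaring and the choice of square roots *)

Lemma BsetN (lam b : F) (e1 e2 : int) : (- b \in Bset lam e1 e2) = (b \in Bset lam e2 e1).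
Proof. by rewrite !inE opprK andbC. Qed.

(** B_2^{--} is stable under negation and has m elements, so the sign is (-1)^m, the symbol of 2. *)
Lemma prod_Bset_mm_opp (b : F) :
  \prod_(a in Bset (2 : F) (-1) (-1)) (- b - a)
  = (legendre (2 : F))%:~R * \prod_(a in Bset (2 : F) (-1) (-1)) (b - a).
Proof.
rewrite legendre2 rmorphXn rmorphN rmorph1 -card_Bset_mm -prodrN.
rewrite (reindex_inj (inv_inj (@opprK F))).
apply: eq_big => [a|a _].
  by rewrite BsetN.
by rewrite opprB opprK addrC.
Qed.

(** Passing from b to -b exchanges the two symbols, which is impossible when they differ. *)
Lemma sqr_inj_Bset (lam : F) (e1 e2 : int) : e1 != e2 ->
  {in Bset lam e1 e2 &, injective (fun b => b ^+ 2)}.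
Proof.
move=> e12 b c; rewrite !inE => /andP[/eqP b1 _] /andP[_ /eqP c2] /eqP.
rewrite eqf_sqr => /orP[/eqP // | /eqP Db].
by move: e12; rewrite -b1 -c2 Db opprK eqxx.
Qed.

(** With b' = b^2 - 2 one has 2 - b' = (2 - b)(2 + b) and 2 + b' = b^2, where b != 0 because at 0
    the two symbols agree. *)
Lemma Bset_mp_map (b : F) : b \in Bset (2 : F) (-1) 1 -> b ^+ 2 - 2 \in Bset (2 : F) (-1) 1.
Proof.
rewrite !inE => /andP[/eqP bm /eqP bp].
have b0 : b != 0.
  by apply: contra_eq_neq bm => b0; rewrite b0 subr0; move: bp; rewrite b0 addr0 => ->.
have -> : 2 - (b ^+ 2 - 2) = (2 - b) * (2 + b) by ring.
by rewrite (addrC 2 (_ - 2)) subrK legendreX2 // legendreM bm bp.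
Qed.

Lemma uniq_sqrt_mp (lam c c' : F) : c \in Bset lam (-1) 1 ->
  c' ^+ 2 = c ^+ 2 -> legendre (c' + lam) = 1 -> c' = c.
Proof.
rewrite inE => /andP[/eqP cm _] /eqP; rewrite eqf_sqr => /orP[/eqP // | /eqP->].
by rewrite addrC cm.
Qed.

Lemma uniq_sqrt_pm (lam c c' : F) : c \in Bset lam 1 (-1) ->
  c' ^+ 2 = c ^+ 2 -> legendre (c' + lam) = -1 -> c' = c.
Proof.
rewrite inE => /andP[/eqP cp _] /eqP; rewrite eqf_sqr => /orP[/eqP // | /eqP->].
by rewrite addrC cp.
Qed.

(** * Rescaling from [lam] to 2 *)

Section Rescaling.
Variable lam : F.
Hypothesis lam0 : lam != 0.

Let nu := legendre (2 * lam).
Let k : F := 2 * nu%:~R / lam.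

Lemma nu_values : nu = 1 \/ nu = -1.
Proof.
have : nu != 0 by rewrite legendre_eq0 mulf_neq0 ?two_neq0.
by have := legendre_values (2 * lam); rewrite -/nu !inE => /or3P[]/eqP->; auto.
Qed.

Lemma nu_sqr : nu%:~R * nu%:~R = 1 :> F.
Proof. by case: nu_values => ->; rewrite ?rmorphN rmorph1 ?mulrNN mulr1. Qed.

Lemma scale_neq0 : k != 0.
Proof.
rewrite /k !mulf_neq0 ?invr_eq0 ?two_neq0 //.
by apply/eqP => n0; have := nu_sqr; rewrite n0 mul0r => /esym/eqP; rewrite oner_eq0.
Qed.

(** The elements 2/lam and 2 lam differ by a square factor, so multiplication by 2/lam multiplies
    symbols by [nu]. When nu = -1, k is -2/lam, which also exchanges lam - b and lam + b. *)
Lemma mem_Bset_scale (b : F) (e1 e2 : int) :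
  (k * b \in Bset (2 : F) e1 e2) =
  if nu == 1 then b \in Bset lam e1 e2 else b \in Bset lam (- e2) (- e1).
Proof.
have L2 (y : F) : legendre (2 / lam * y) = nu * legendre y.
  have -> : 2 / lam * y = 2 * lam * (lam^-1 ^+ 2 * y) by field.
  by rewrite legendreM -/nu legendreM legendreX2 ?invr_eq0 // mul1r.
rewrite !inE /k; case: nu_values => Dnu; rewrite Dnu /=.
  rewrite (_ : 2 - _ = 2 / lam * (lam - b)); last by rewrite rmorph1; field.
  rewrite (_ : 2 + _ = 2 / lam * (lam + b)); last by rewrite rmorph1; field.
  by rewrite !L2 Dnu !mul1r.
rewrite (_ : 2 - _ = 2 / lam * (lam + b)); last by rewrite rmorphN rmorph1; field.
rewrite (_ : 2 + _ = 2 / lam * (lam - b)); last by rewrite rmorphN rmorph1; field.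
by rewrite !L2 Dnu !mulN1r !eqr_oppLR andbC.
Qed.

(** Negating and exchanging the signs fixes (-, +), so both values of [nu] give the same set. *)
Lemma mem_Bset_scale_mp (b : F) : (b \in Bset lam (-1) 1) = (k * b \in Bset (2 : F) (-1) 1).
Proof. by rewrite mem_Bset_scale opprK if_same. Qed.

Lemma mem_Bset_scale_pm (b : F) : (b \in Bset lam 1 (-1)) = (k * b \in Bset (2 : F) 1 (-1)).
Proof. by rewrite mem_Bset_scale opprK if_same. Qed.

Lemma mem_Bset_scale_mm (b : F) :
  (b \in Bset lam (- nu) (- nu)) = (k * b \in Bset (2 : F) (-1) (-1)).
Proof. by rewrite mem_Bset_scale; case: nu_values => ->. Qed.

(** Each of the m factors absorbs one [k]; one [k] is kept outside because the root for 2 is [k]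
    times the root for [lam]. *)
Lemma prod_Bset_scale (b : F) :
  k * (k ^+ (m_of F).-1 * \prod_(a in Bset lam (- nu) (- nu)) (b - a))
  = \prod_(a in Bset (2 : F) (-1) (-1)) (k * b - a).
Proof.
have kI := mulfI scale_neq0.
have cardB : #|Bset lam (- nu) (- nu)| = m_of F.
  rewrite -card_Bset_mm -!sum1_card [RHS](reindex_inj kI).
  by apply: eq_bigl => a; rewrite mem_Bset_scale_mm.
rewrite mulrA -exprS prednK ?m_of_gt0 // -{1}cardB -prodr_const -big_split /=.
rewrite [RHS](reindex_inj kI); apply: eq_big => [a|a _]; first exact: mem_Bset_scale_mm.
by rewrite mulrBr.
Qed.

End Rescaling.

End OddFiniteField.

Theorem theorem7p1 (F : finFieldType) (Hq : odd #|F|) :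
  (* (i) *)
  [/\ {in Bset (2 : F) (-1) 1, forall b, b ^+ 2 - 2 \in Bset (2 : F) (-1) 1},
      {in Bset (2 : F) (-1) 1 &, injective (fun b : F => b ^+ 2 - 2)} &
      {in Bset (2 : F) (-1) 1, forall b,
         let c := \prod_(a in Bset (2 : F) (-1) (-1)) (b - a) in
         [/\ c \in Bset (2 : F) (-1) 1, c ^+ 2 - 2 = b,
             c ^+ 2 = 2 + b, legendre (2 + c) = 1 &
             forall c' : F, c' ^+ 2 = 2 + b -> legendre (2 + c') = 1 -> c' = c]}]
  /\
  (* (ii) *)
  [/\ {in Bset (2 : F) 1 (-1), forall b, 2 - b ^+ 2 \in Bset (2 : F) 1 (-1)},
      {in Bset (2 : F) 1 (-1) &, injective (fun b : F => 2 - b ^+ 2)} &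
      {in Bset (2 : F) 1 (-1), forall b,
         let c := - (legendre (2 : F))%:~R * \prod_(a in Bset (2 : F) (-1) (-1)) (b - a) in
         [/\ c \in Bset (2 : F) 1 (-1), 2 - c ^+ 2 = b,
             c ^+ 2 = 2 - b, legendre (c + 2) = -1 &
             forall c' : F, c' ^+ 2 = 2 - b -> legendre (c' + 2) = -1 -> c' = c]}]
  /\
  (* (iii) *)
  (forall lam : F, lam != 0 ->
    let nu : int := legendre (2 * lam) in
    let k : F := 2 * nu%:~R / lam in
    let pil := fun b : F => k * b ^+ 2 - nu%:~R * lam in
    let sigl := fun b : F => - (k * b ^+ 2) + nu%:~R * lam in
    [/\ {in Bset lam (-1) 1, forall b, pil b \in Bset lam (-1) 1},
        {in Bset lam (-1) 1 &, injective pil},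
        {in Bset lam 1 (-1), forall b, sigl b \in Bset lam 1 (-1)} &
        {in Bset lam 1 (-1) &, injective sigl}] /\
    [/\ {in Bset lam (-1) 1, forall b,
           let c := k ^+ (m_of F).-1 * \prod_(a in Bset lam (- nu) (- nu)) (b - a) in
           [/\ c \in Bset lam (-1) 1, pil c = b,
               c ^+ 2 = (lam * nu%:~R * b + lam ^+ 2) / 2, legendre (c + lam) = 1 &
               forall c' : F, c' ^+ 2 = (lam * nu%:~R * b + lam ^+ 2) / 2 ->
                 legendre (c' + lam) = 1 -> c' = c]} &
        {in Bset lam 1 (-1), forall b,
           let c := - (legendre (2 : F))%:~R * k ^+ (m_of F).-1 *
                    \prod_(a in Bset lam (- nu) (- nu)) (b - a) in
           [/\ c \in Bset lam 1 (-1), sigl c = b,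
               c ^+ 2 = (- (lam * nu%:~R * b) + lam ^+ 2) / 2, legendre (c + lam) = -1 &
               forall c' : F, c' ^+ 2 = (- (lam * nu%:~R * b) + lam ^+ 2) / 2 ->
                 legendre (c' + lam) = -1 -> c' = c]}]).
Proof.
have prod_mp b := @prod_Bset_mm_sqrt F Hq b.
(* This is the (-, +) case at [- b], followed by negation of the root; [prod_Bset_mm_opp] supplies
   the symbol of 2. *)
have prod_pm (b : F) : b \in Bset (2 : F) 1 (-1) ->
    let c := - (legendre (2 : F))%:~R * \prod_(a in Bset (2 : F) (-1) (-1)) (b - a) in
    c \in Bset (2 : F) 1 (-1) /\ c ^+ 2 = 2 - b.
  rewrite -BsetN => /prod_mp /=; rewrite prod_Bset_mm_opp // => -[cB c2].
  by rewrite mulNr BsetN sqrrN.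
have map_pm (b : F) : b \in Bset (2 : F) 1 (-1) -> 2 - b ^+ 2 \in Bset (2 : F) 1 (-1).
  by rewrite -BsetN => /(Bset_mp_map Hq); rewrite sqrrN -BsetN opprB.
split; [split | split; [split |]].
- exact: Bset_mp_map.
- by move=> b c bB cB /addIr; apply: sqr_inj_Bset bB cB.
- move=> b /prod_mp[]; set c := \prod_(_ in _) _ => cB c2.
  split=> //; first by rewrite c2 addrC addKr.
    by move: cB; rewrite inE => /andP[_ /eqP].
  by move=> c' c'2; rewrite addrC; apply: uniq_sqrt_mp cB _; rewrite c2.
- exact: map_pm.
- by move=> b c bB cB /addrI/oppr_inj; apply: sqr_inj_Bset bB cB.
- move=> b /prod_pm[]; set c := - _ * _ => cB c2.
  split=> //; first by rewrite c2 subKr.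
    by move: cB; rewrite inE (addrC c) => /andP[_ /eqP].
  by move=> c' c'2; apply: uniq_sqrt_pm cB _; rewrite c2.
move=> lam lam0 nu k pil sigl.
have k0 : k != 0 by apply: scale_neq0.
have nu2 : nu%:~R * nu%:~R = 1 :> F by apply: nu_sqr.
have nu0 : nu%:~R != 0 :> F.
  by apply/eqP => n0; have /esym/eqP := nu2; rewrite n0 mul0r oner_eq0.
have F20 := two_neq0 Hq.
have klam : k * (nu%:~R * lam) = 2.
  have -> : k * (nu%:~R * lam) = 2 * (nu%:~R * nu%:~R) by rewrite /k; field.
  by rewrite nu2 mulr1.
(* Multiplication by [k] conjugates [pil] and [sigl] to the maps for 2. *)
have kpil b : k * pil b = (k * b) ^+ 2 - 2 by rewrite mulrBr klam; ring.
have ksigl b : k * sigl b = 2 - (k * b) ^+ 2 by rewrite mulrDr klam; ring.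
have Smp b : (b \in Bset lam (-1) 1) = (k * b \in Bset (2 : F) (-1) 1).
  exact: mem_Bset_scale_mp.
have Spm b : (b \in Bset lam 1 (-1)) = (k * b \in Bset (2 : F) 1 (-1)).
  exact: mem_Bset_scale_pm.
have kprod b := prod_Bset_scale Hq lam0 b.
(* This serves both formulas for [c ^+ 2]; the one for [sigl] is the instance at [- b]. *)
have half_kM b : k * ((lam * nu%:~R * b + lam ^+ 2) / 2) = b + nu%:~R * lam.
  have -> : b + nu%:~R * lam = nu%:~R * nu%:~R * b + nu%:~R * lam by rewrite nu2 mul1r.
  by rewrite /k; field; rewrite F20.
split; split.
- by move=> b; rewrite !Smp kpil; apply: Bset_mp_map.
- by move=> b c bB cB /addIr/(mulfI k0); apply: sqr_inj_Bset bB cB.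
- by move=> b; rewrite !Spm ksigl; apply: map_pm.
- by move=> b c bB cB /addIr/oppr_inj/(mulfI k0); apply: sqr_inj_Bset bB cB.
- move=> b; rewrite Smp => /prod_mp; rewrite -kprod /=.
  set c := _ * \prod_(_ in _) _ => -[cB c2].
  have Dpil : pil c = b by apply: (mulfI k0); rewrite kpil c2 addrC addKr.
  have Dc : c ^+ 2 = (lam * nu%:~R * b + lam ^+ 2) / 2.
    by apply: (mulfI k0); rewrite half_kM -Dpil subrK.
  rewrite -Smp in cB; split=> //.
    by move: cB; rewrite inE (addrC c) => /andP[_ /eqP].
  by move=> c' c'2; apply: uniq_sqrt_mp cB _; rewrite Dc.
move=> b; rewrite Spm => /prod_pm; rewrite -kprod mulrCA (mulrA (- _)) /=.
set c := _ * \prod_(_ in _) _ => -[cB c2].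
have Dsigl : sigl c = b by apply: (mulfI k0); rewrite ksigl c2 subKr.
have Dc : c ^+ 2 = (- (lam * nu%:~R * b) + lam ^+ 2) / 2.
  by apply: (mulfI k0); rewrite -mulrN half_kM -Dsigl opprD opprK subrK.
rewrite -Spm in cB; split=> //.
  by move: cB; rewrite inE (addrC c) => /andP[_ /eqP].
by move=> c' c'2; apply: uniq_sqrt_pm cB _; rewrite Dc.
Qed.
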